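(* Let $\rho$ be a positive integer, let $q'$ be a prime power, $q=(q')^{\rho+1}$, and let $v\geq\rho+1$. Then every $(\rho+1)$-fold strong blocking set in the subgeometry $PG(v,q')\subset PG(v,q)$ is a $\rho$-saturating set in $PG(v,q)$.
   Context: $PG(v,q)$ is the $v$-dimensional projective space over $F_q$; the subgeometry $PG(v,q')\subset PG(v,q)$ consists of the points admitting homogeneous coordinates with all entries in $F_{q'}$, with its subspaces being those spanned by such points. For $2\leq t\leq v$, a point set $B$ in $PG(v,q')$ is a $t$-fold strong blocking set if every $(t-1)$-dimensional subspace of $PG(v,q')$ is spanned by $t$ points of $B$. A point set $S\subseteq PG(v,q)$ is $\varrho$-saturating if for every point $x\in PG(v,q)$ there exist $\varrho+1$ points of $S$ generating a subspace of $PG(v,q)$ containing $x$, and $\varrho$ is the smallest value with this property. *)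

(* Defs.v *)
From HB Require Import structures.
From mathcomp Require Import all_boot all_order all_algebra.

Set Implicit Arguments.
Unset Strict Implicit.
Unset Printing Implicit Defensive.

Import GRing.Theory.
Local Open Scope ring_scope.

Section FiniteSpaces.
Variables (K : finFieldType) (vT : vectType K).
HB.instance Definition _ : isCountable {vspace vT} :=
  CanIsCountable (@VectorInternalTheory.vs2mxK K vT).
HB.instance Definition _ : isFinite {vspace vT} :=
  CanIsFinite (@VectorInternalTheory.vs2mxK K vT).
End FiniteSpaces.

(* PG(v, K) is the lattice of subspaces of K^(v+1): a subspace of projective  *)
(* dimension d is a vector subspace of dimension d + 1, a point is a line.    *)
Section ProjectiveSpace.
Variables (v : nat) (K : finFieldType).

Definition pgpoint := {P : {vspace 'rV[K]_v.+1} | \dim P == 1%N}.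

HB.instance Definition _ := SubFinite.on pgpoint.

Definition pgspan (A : {set pgpoint}) : {vspace 'rV[K]_v.+1} :=
  (\sum_(P in A) val P)%VS.

Definition pg_covers (r : nat) (S : {set pgpoint}) : Prop :=
  forall x : pgpoint, exists A : {set pgpoint},
    [/\ A \subset S, #|A| = r.+1 & (val x <= pgspan A)%VS].

Definition saturating (r : nat) (S : {set pgpoint}) : Prop :=
  pg_covers r S /\ forall r', (r' < r)%N -> ~ pg_covers r' S.

End ProjectiveSpace.

(* A field morphism iota realises F as a subfield of K, hence PG(v, F) as a   *)
(* subgeometry of PG(v, K).                                                   *)
Section Subgeometry.
Variables (v : nat) (F K : finFieldType) (iota : {rmorphism F -> K}).

Definition subgeom : {set pgpoint v K} :=
  [set P | [exists u : 'rV[F]_v.+1, val P == <[map_mx iota u]>%VS]].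

(* Spans are taken in PG(v, K): a subspace of the subgeometry is represented  *)
(* by the subspace of PG(v, K) that its points generate.                      *)
Definition subgeom_subspace (W : {vspace 'rV[K]_v.+1}) : Prop :=
  exists2 A : {set pgpoint v K}, A \subset subgeom & W = pgspan A.

Definition strong_blocking (t : nat) (B : {set pgpoint v K}) : Prop :=
  B \subset subgeom /\
  forall W : {vspace 'rV[K]_v.+1}, subgeom_subspace W -> \dim W = t ->
    exists A : {set pgpoint v K}, [/\ A \subset B, #|A| = t & W = pgspan A].

End Subgeometry.

(* Main.v *)
Require Import Defs.
From mathcomp Require Import all_boot all_order all_algebra.

Set Implicit Arguments.
Unset Strict Implicit.
Unset Printing Implicit Defensive.

Import GRing.Theory.
Local Open Scope ring_scope.

(* A basis e of K over F turns a vector w over K into a combination           *)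
(* e_0 u_0 + ... + e_rho u_rho of vectors over F, so every point lies in a    *)
(* subgeometry subspace of dimension at most rho, which can be enlarged to    *)
(* dimension exactly rho and is then spanned by rho + 1 points of B.          *)
(* Conversely the point (e_0, ..., e_rho, 0, ..., 0) lies in no span of at    *)
(* most rho subgeometry points: some nonzero c over F supported on the first  *)
(* rho + 1 coordinates is orthogonal to all of them, and would give a         *)
(* relation \sum_i c_i e_i = 0 over F.                                        *)

(** Both halves rest on the bijection [F^(rho+1) -> K] of [bij_lin_comb_exists]. Covering uses its
    surjectivity, with [row_free_extension] and [row_free_subgeom] providing a subspace of the right
    dimension; minimality uses its injectivity, with [subgeom_annihilator] providing the forbidden
    relation. *)

Definition lin_comb (F K : finFieldType) (iota : {rmorphism F -> K}) n
  (e : 'rV[K]_n) (c : 'cV[F]_n) : 'M[K]_1 := e *m map_mx iota c.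

(** Greedy choice: as long as [#|F| ^ n < #|K|], the [F]-span of [e] misses some [x] in [K], and
    prepending [x] keeps the entries independent over [F]. *)
Lemma inj_lin_comb_exists (F K : finFieldType) (iota : {rmorphism F -> K}) n :
  (#|F| ^ n <= #|K|)%N -> exists e : 'rV[K]_n, injective (lin_comb iota e).
Proof.
elim: n => [|n IHn] leFK.
  by exists 0 => c d _; rewrite [c]flatmx0 [d]flatmx0.
have ltFK: (#|F| ^ n < #|K|)%N.
  by apply: leq_trans leFK; rewrite ltn_exp2l // card_finNzRing_gt1.
have [e inj_e] := IHn (ltnW ltFK).
have [x x_notin]: exists x : K, x%:M \notin codom (lin_comb iota e).
  apply/existsP; rewrite -negb_forall; apply: contraL ltFK => /forallP x_in.
  have inj_scal : injective (fun y : K => y%:M : 'M_1).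
    by move=> y z /matrixP/(_ 0 0); rewrite !mxE eqxx.
  have cardFn : #|{: 'cV[F]_n}| = (#|F| ^ n)%N by rewrite card_mx muln1.
  rewrite -leqNgt -cardFn -(card_codom inj_e) -(card_codom inj_scal).
  by apply/subset_leq_card/subsetP => _ /codomP[y ->].
suff inj_xe (a a' : 'cV[F]_1) (b b' : 'cV[F]_n) :
    lin_comb iota (row_mx x%:M e) (col_mx a b) =
      lin_comb iota (row_mx x%:M e) (col_mx a' b') -> col_mx a b = col_mx a' b'.
  exists (row_mx x%:M e : 'rV_(1 + n)) => c d.
  by rewrite -[c](@vsubmxK _ 1 n) -[d](@vsubmxK _ 1 n) => /inj_xe.
rewrite /lin_comb => /eqP; rewrite -subr_eq0 -mulmxBr -map_mxB => /eqP.
rewrite opp_col_mx add_col_mx map_col_mx mul_row_col mul_scalar_mx => eq0.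
have [eq_a|neq_a] := eqVneq a a'.
  move: eq0; rewrite eq_a subrr raddf0 scaler0 add0r map_mxB mulmxBr.
  by move/eqP; rewrite subr_eq0 => /eqP/inj_e->.
(* A nonzero coefficient at [x] could be divided out, putting [x] in the span of [e]. *)
case/negP: x_notin; apply/codomP; exists (- ((a - a') 0 0)^-1 *: (b - b')).
have nz: (a - a') 0 0 != 0.
  apply: contraNneq neq_a => a0; rewrite -subr_eq0; apply/eqP/matrixP=> i j.
  by rewrite !ord1 a0 mxE.
rewrite /lin_comb map_mxZ -scalemxAr.
rewrite -(addr0_eq eq0) rmorphN /= scaleNr scalerN opprK scalerA.
apply/matrixP => i j; rewrite !ord1 [LHS]mxE [RHS]mxE [map_mx _ _ _ _]mxE.
by rewrite fmorphV eqxx mulr1n mulrAC mulVf ?mul1r // fmorph_eq0.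
Qed.

Lemma bij_lin_comb_exists (F K : finFieldType) (iota : {rmorphism F -> K}) n :
  #|K| = (#|F| ^ n)%N -> exists e : 'rV[K]_n, bijective (lin_comb iota e).
Proof.
move=> cardK; have [|e inj_e] := @inj_lin_comb_exists F K iota n.
  by rewrite cardK.
by exists e; apply: inj_card_bij => //; rewrite !card_mx !muln1 cardK.
Qed.

(** The first [\rank M] rows of the invertible matrix [row_ebase M] span the row space of [M]; its
    first [m] rows are still independent. *)
Lemma row_free_extension (F : fieldType) m n (M : 'M[F]_(m, n)) :
  (m <= n)%N -> exists2 N : 'M[F]_(m, n), row_free N & (M <= N)%MS.
Proof.
move=> le_mn; exists (pid_mx m *m row_ebase M).
  have ebase_free : row_free (row_ebase M) by rewrite row_free_unit row_ebase_unit.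
  by rewrite /row_free mxrankMfree // rank_pid_mx.
apply/submxP; exists (col_ebase M *m pid_mx (\rank M)).
rewrite -mulmxA (mulmxA (pid_mx _)) mul_pid_mx -{1}[M]mulmx_ebase mulmxA.
by rewrite (minn_idPl (rank_leq_row M)) (minn_idPr (rank_leq_row M)).
Qed.

Section SubgeometryPoints.
Variables (v : nat) (F K : finFieldType) (iota : {rmorphism F -> K}).

Lemma pgpoint_line (P : pgpoint v K) :
  exists2 w : 'rV[K]_v.+1, w != 0 & val P = <[w]>%VS.
Proof.
have dimP : \dim (val P) = 1%N by apply/eqP; exact: valP P.
exists (vpick (val P)); first by rewrite vpick0 -dimv_eq0 dimP.
apply/esym/eqP; rewrite eqEdim -memvE memv_pick /= dimP dim_vline vpick0.
by rewrite -dimv_eq0 dimP.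
Qed.

Lemma line_pgpoint (w : 'rV[K]_v.+1) :
  w != 0 -> exists P : pgpoint v K, val P = <[w]>%VS.
Proof.
move=> nz_w; have dimw : \dim <[w]> == 1%N by rewrite dim_vline nz_w.
by exists (Sub <[w]>%VS dimw); rewrite SubK.
Qed.

Lemma dim_pgspan (A : {set pgpoint v K}) : (\dim (pgspan A) <= #|A|)%N.
Proof.
apply: leq_trans (dimv_leq_sum _ _ _) _.
by rewrite -sum1_card leq_sum // => P _; rewrite (eqP (valP P)).
Qed.

(** The points are the rows of [N] read over [K]: extending scalars preserves rank, so they stay
    nonzero and independent. *)
Lemma row_free_subgeom n (N : 'M[F]_(n, v.+1)) :
    row_free N ->
  exists A : {set pgpoint v K}, [/\ A \subset subgeom v iota,
    \dim (pgspan A) = n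
    & forall c : 'rV[K]_n, c *m map_mx iota N \in pgspan A].
Proof.
move=> freeN; set M := map_mx iota N.
have freeM : row_free M by rewrite /row_free mxrank_map.
have nzM i : row i M != 0.
  apply/eqP; rewrite rowE -(mul0mx _ M) => /(row_free_inj freeM)/rowP/(_ i).
  by rewrite !mxE !eqxx => /eqP; rewrite oner_eq0.
have /fin_all_exists[p pE] i := line_pgpoint (nzM i).
pose A := [set p i | i in 'I_n].
have rowA i : row i M \in pgspan A.
  by apply: (subvP (sumv_sup (p i) (imset_f _ _) _)) (memv_line _); rewrite ?pE.
have combA (c : 'rV_n) : c *m M \in pgspan A.
  by rewrite mulmx_sum_row memv_suml // => i _; rewrite memvZ.
exists A; split=> //.
  apply/subsetP => _ /imsetP[i _ ->]; rewrite inE; apply/existsP.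
  by exists (row i N); rewrite map_row -pE.
apply/eqP; rewrite eqn_leq; apply/andP; split.
  by rewrite (leq_trans (dim_pgspan _)) // -[leqRHS]card_ord leq_imset_card.
have /eqP dimX : free [tuple row i M | i < n].
  apply/freeP => k sum0 i.
  suff : \row_j k j = 0 by move/rowP/(_ i); rewrite !mxE.
  apply: (row_free_inj freeM); rewrite mul0mx mulmx_sum_row -[RHS]sum0.
  by apply: eq_bigr => j _; rewrite mxE -tnth_nth tnth_mktuple.
rewrite -[leqLHS](size_tuple [tuple row i M | i < n]) -dimX dimvS //.
by apply/span_subvP => _ /tnthP[i ->]; rewrite tnth_mktuple.
Qed.

(** Orthogonality of [c *m E] to [F]-representatives of the points of [A] is a system of [#|A| < n]
    equations over [F] in [n] unknowns; a nonzero solution then annihilates the whole [K]-span. *)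
Lemma subgeom_annihilator n (A : {set pgpoint v K}) (E : 'M[F]_(n, v.+1)) :
    A \subset subgeom v iota -> (#|A| < n)%N ->
  exists2 c : 'rV[F]_n, c != 0
    & forall w, w \in pgspan A -> w *m map_mx iota (c *m E)^T = 0.
Proof.
move=> sAG ltAn.
have /fin_all_exists[u uE] (P : pgpoint v K) : exists u : 'rV[F]_v.+1,
    P \in A -> val P = <[map_mx iota u]>%VS.
  have [/(subsetP sAG)|_] := boolP (P \in A); last by exists 0.
  by rewrite inE => /existsP[u /eqP->]; exists u.
pose U : 'M[F]_(#|A|, v.+1) := \matrix_i u (enum_val i).
pose c := nz_row (kermx (E *m U^T)).
have cEU : c *m (E *m U^T) = 0 by apply/sub_kermxP/nz_row_sub.
exists c.
  rewrite nz_row_eq0 -mxrank_eq0 mxrank_ker subn_eq0 -ltnNge.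
  by rewrite (leq_ltn_trans (rank_leq_col _)).
move=> w /memv_sumP[vs vsP ->]; rewrite mulmx_suml big1 // => P PA.
have := vsP P PA; rewrite uE // => /vlineP[k ->].
rewrite -scalemxAl -map_mxM; suff ->: u P *m (c *m E)^T = 0.
  by rewrite map_mx0 scaler0.
have ->: u P = row (enum_rank_in PA P) U by rewrite rowK enum_rankK_in.
apply: trmx_inj; rewrite -row_mul trmx0 tr_row trmx_mul trmxK -mulmxA cEU.
by rewrite col0.
Qed.

End SubgeometryPoints.

Theorem theorem2 (rho v : nat) (F K : finFieldType)
    (iota : {rmorphism F -> K}) (B : {set pgpoint v K}) :
  (0 < rho)%N ->
  #|K| = (#|F| ^ rho.+1)%N ->
  (rho.+1 <= v)%N ->
  strong_blocking iota rho.+1 B ->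
  saturating rho B.
Proof.
move=> _ cardK le_rv [sBG blockB].
have [e bij_e] := bij_lin_comb_exists iota cardK.
have inj_e := bij_inj bij_e; have [d _ dK] := bij_e.
split=> [x|r lt_r covB].
  have [w _ ->] := pgpoint_line x.
  (* Column [j] holds the [F]-coordinates of the [j]-th entry of [w] in the basis [e]. *)
  pose M := \matrix_(i < rho.+1, j < v.+1) d (col j w) i 0.
  have wE : w = e *m map_mx iota M.
    apply/rowP => j; have /matrixP/(_ 0 0) := dK (col j w).
    rewrite /lin_comb [in RHS]mxE => <-; rewrite !mxE.
    by apply: eq_bigr => i _; rewrite !mxE.
  (* The rows of [M] may be dependent, while [blockB] needs dimension exactly [rho.+1]. *)
  have [|N freeN /submxP[D MD]] := @row_free_extension F _ _ M.
    exact: leq_trans le_rv _.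
  have [A0 [sA0G dimA0 combA0]] := row_free_subgeom iota freeN.
  have [|A [sAB cardA eqA]] := blockB _ _ dimA0; first by exists A0.
  by exists A; split; rewrite // -eqA -memvE wE MD map_mxM mulmxA.
pose E : 'M[F]_(rho.+1, v.+1) := pid_mx rho.+1.
have EEt : E *m E^T = 1%:M.
  by rewrite tr_pid_mx mul_pid_mx !minnn (minn_idPr _) ?pid_mx_1 ?ltnS ?(ltnW le_rv).
(* This is [e] padded with zeros; pairing it with [c *m E] returns the combination of [e] with
   coefficients [c]. *)
pose w := e *m map_mx iota E.
have wE (c : 'rV[F]_rho.+1) : w *m map_mx iota (c *m E)^T = lin_comb iota e c^T.
  by rewrite /w -mulmxA -map_mxM trmx_mul mulmxA EEt mul1mx.
have lin_comb_eq0 (c : 'rV[F]_rho.+1) : lin_comb iota e c^T = 0 -> c = 0.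
  move=> ec0; apply: trmx_inj; apply: inj_e.
  by rewrite ec0 trmx0 /lin_comb map_mx0 mulmx0.
have nz_w : w != 0.
  apply/eqP => w0; have := wE (const_mx 1); rewrite w0 mul0mx.
  by move/esym/lin_comb_eq0/rowP/(_ 0)/eqP; rewrite !mxE oner_eq0.
have [x xE] := line_pgpoint nz_w.
have [A [sAB cardA xA]] := covB x.
(* [A] has [r.+1 < rho.+1] points, so there are fewer equations than rows of [E]. *)
have [|c nz_c cA] := subgeom_annihilator E (subset_trans sAB sBG).
  by rewrite cardA.
case/eqP: nz_c; apply: lin_comb_eq0; rewrite -wE cA //.
by rewrite memvE -xE.
Qed.
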